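(* Let $(Q,\cdot)$ be a uniquely $2$-divisible commutative automorphic loop with associated Bruck loop $(Q,\circ)$. Then $Z_n(Q,\circ)=Z_n(Q,\cdot)$ for every $n\ge 0$.
   Context: A loop $(Q,\cdot)$ is a set with a binary operation such that for each $x\in Q$ the left translation $L_x:y\mapsto xy$ and the right translation $R_x:y\mapsto yx$ are bijections of $Q$, and there is $1\in Q$ with $1\cdot x=x\cdot 1=x$ for all $x$. The multiplication group is the permutation group generated by all $L_x,R_x$; the inner mapping group $\mathrm{Inn}\,Q$ is the stabilizer of $1$ in it. $Q$ is automorphic if every element of $\mathrm{Inn}\,Q$ is an automorphism of $Q$. Automorphic loops are power-associative ($x^mx^n=x^{m+n}$ for all integers $m,n$). Left division $x\backslash y$ is the unique $z$ with $xz=y$. $(Q,\cdot)$ is uniquely $2$-divisible if $x\mapsto x^2$ is a permutation of $Q$; $x^{1/2}$ denotes the unique element whose square is $x$. Associated Bruck loop: for a uniquely $2$-divisible commutative automorphic loop $(Q,\cdot)$ define $x\circ y=[x^{-1}\backslash(xy^2)]^{1/2}$. It is known that $(Q,\circ)$ is a Bruck loop, i.e. a loop satisfying $(x\circ(y\circ x))\circ z=x\circ(y\circ(x\circ z))$ and $(x\circ y)^{-1}=x^{-1}\circ y^{-1}$, with the same identity element, and that powers in $(Q,\circ)$ coincide with powers in $(Q,\cdot)$. The center of a loop is $Z(Q)=\{a\in Q: ax=xa,\ ax\cdot y=a\cdot xy,\ xa\cdot y=x\cdot ay,\ xy\cdot a=x\cdot ya\ \text{for all }x,y\in Q\}$,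 a normal subloop (a subloop invariant under $\mathrm{Inn}\,Q$). Put $Z_0(Q)=\{1\}$ and let $Z_{i+1}(Q)$ be the preimage of $Z(Q/Z_i(Q))$ under the canonical projection $Q\to Q/Z_i(Q)$. $Z_n(Q,\cdot)$ and $Z_n(Q,\circ)$ are these subsets computed in the respective loops. *)

(* Defs.v *)
From mathcomp Require Import all_boot all_classical.

Set Implicit Arguments.
Unset Strict Implicit.
Unset Printing Implicit Defensive.

Local Open Scope classical_set_scope.

Section Loops.
Context {Q : Type}.
Implicit Types (mul : Q -> Q -> Q) (e x y : Q) (N : set Q).

Definition is_loop mul e :=
  [/\ forall x, bijective (mul x), forall x, bijective (mul^~ x),
      left_id e mul & right_id e mul].

Inductive Mlt mul : set (Q -> Q) :=
| Mlt_left x : Mlt mul (mul x)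
| Mlt_right x : Mlt mul (mul^~ x)
| Mlt_id : Mlt mul id
| Mlt_comp f g : Mlt mul f -> Mlt mul g -> Mlt mul (f \o g)
| Mlt_inv f g : Mlt mul f -> cancel f g -> cancel g f -> Mlt mul g.

Definition Inn mul e : set (Q -> Q) := Mlt mul `&` [set f | f e = e].

Definition automorphism mul (f : Q -> Q) :=
  bijective f /\ {morph f : x y / mul x y}.

Definition automorphic mul e := Inn mul e `<=` automorphism mul.

Definition square mul x := mul x x.

Definition uniquely_2_divisible mul := bijective (square mul).

(* The inverse of a bijection f of Q; the point e is only a default value,
   returned outside the range of f. *)
Definition inverse e (f : Q -> Q) : Q -> Q := 'pinv_(fun=> e) setT f.

Definition ldiv mul e x y := inverse e (mul x) y.

Definition loop_inv mul e x := ldiv mul e x e.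

Definition sqrt mul e x := inverse e (square mul) x.

Definition bruck_mul mul e x y :=
  sqrt mul e (ldiv mul e (loop_inv mul e x) (mul x (square mul y))).

Definition subloop mul e N :=
  [/\ N e, forall x y, N x -> N y -> N (mul x y),
      forall x y, N x -> N (mul x y) -> N y &
      forall x y, N y -> N (mul x y) -> N x].

Definition normal_subloop mul e N :=
  subloop mul e N /\ forall f x, Inn mul e f -> N x -> N (f x).

Definition coset mul N x : set Q := mul x @` N.

Definition quotient mul N := {C : set Q | range (coset mul N) C}.

Definition quotient_proj mul N x : quotient mul N :=
  exist _ (coset mul N x) (imageT (coset mul N) x).

Definition quotient_repr mul N (C : quotient mul N) : Q :=
  sval (cid2 (svalP C)).

(* (xN)(yN) = (xy)N, computed on chosen representatives; the choice is
   immaterial when N is normal, see quotient_projM. *)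
Definition quotient_mul mul N (C D : quotient mul N) : quotient mul N :=
  quotient_proj mul N (mul (quotient_repr C) (quotient_repr D)).

End Loops.

Definition center {Q : Type} (mul : Q -> Q -> Q) : set Q :=
  [set a | forall x y, [/\ mul a x = mul x a,
                           mul (mul a x) y = mul a (mul x y),
                           mul (mul x a) y = mul x (mul a y) &
                           mul (mul x y) a = mul x (mul y a)]].

(* Z_n(Q). The definition makes sense for any operation, so that it applies to
   bruck_mul without a proof that the latter is a loop operation; in a loop
   every Z_n(Q) is normal, see upper_center_normal. *)
Fixpoint upper_center {Q : Type} (mul : Q -> Q -> Q) (e : Q) (n : nat)
    : set Q :=
  if n is m.+1 then
    let Z := upper_center mul e m in
    quotient_proj mul Z @^-1` center (@quotient_mul Q mul Z)
  else [set e].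

Section LoopTheory.
Context {Q : Type} (mul : Q -> Q -> Q) (e : Q) (Qloop : is_loop mul e).
Implicit Types (x y : Q) (N : set Q).

Lemma inverseK (f : Q -> Q) :
  bijective f -> cancel f (inverse e f) /\ cancel (inverse e f) f.
Proof.
move=> fbij; have finj := bij_inj fbij; case: fbij => g fg gf.
split=> x; last first.
  by apply: pinvK; rewrite inE; exists (g x).
apply: finj; apply: pinvK; rewrite inE; exact: imageT.
Qed.

Lemma Mlt_bij f : Mlt mul f -> bijective f.
Proof.
case: Qloop => Lb Rb _ _.
elim=> //; first by exists id.
- by move=> g h _ gb _ hb; exact: bij_comp.
- by move=> g h _ _ gh hg; exists g.
Qed.

Lemma Mlt_inverse f : Mlt mul f -> Mlt mul (inverse e f).
Proof. by move=> fM; have [] := inverseK (Mlt_bij fM); exact: Mlt_inv. Qed.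

Lemma coset_Mlt N f x :
  normal_subloop mul e N -> Mlt mul f -> f @` coset mul N x = coset mul N (f x).
Proof.
move=> [_ Ninv] fM; case: (Qloop) => Lb _ _ idr.
pose g := inverse e (mul (f x)) \o (f \o mul x).
have [Lk kL] := inverseK (Lb (f x)).
have gM : Mlt mul g.
  apply: Mlt_comp; first exact: Mlt_inverse (Mlt_left _ _).
  by apply: Mlt_comp => //; exact: Mlt_left.
have ge : g e = e by rewrite /g /= idr -[X in inverse _ _ X]idr Lk.
have [gk kg] := inverseK (Mlt_bij gM).
have gE z : mul (f x) (g z) = f (mul x z) by rewrite /g /= kL.
apply/seteqP; split => y.
  by case=> _ [z Nz <-] <-; exists (g z); [exact: Ninv|exact: gE].
case=> z Nz <-; exists (mul x (inverse e g z)); last by rewrite -gE kg.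
exists (inverse e g z) => //; apply: Ninv => //; split=> /=.
  exact: Mlt_inverse.
by rewrite -[X in inverse _ _ X]ge gk.
Qed.

Lemma quotient_projE N x y :
  (quotient_proj mul N x = quotient_proj mul N y) <->
  (coset mul N x = coset mul N y).
Proof.
split=> [/(congr1 sval)//|xy]; exact: eq_exist.
Qed.

Lemma quotient_reprK N : cancel (@quotient_repr Q mul N) (quotient_proj mul N).
Proof.
move=> C; rewrite /quotient_repr; case: cid2 => /= x _.
by case: C => C CP /= xC; exact: eq_exist.
Qed.

Lemma coset_mul N x x' y y' : normal_subloop mul e N ->
  coset mul N x = coset mul N x' -> coset mul N y = coset mul N y' ->
  coset mul N (mul x y) = coset mul N (mul x' y').
Proof.
move=> Nn xx' yy'.
rewrite -(coset_Mlt y Nn (Mlt_left mul x)) yy' (coset_Mlt _ Nn (Mlt_left mul x)).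
have R z := coset_Mlt z Nn (Mlt_right mul y').
by rewrite -(R x) xx' (R x').
Qed.

Lemma quotient_projM N : normal_subloop mul e N ->
  {morph quotient_proj mul N : x y / mul x y >-> quotient_mul x y}.
Proof.
move=> Nn x y; apply/quotient_projE.
by apply: coset_mul => //; apply/quotient_projE; rewrite quotient_reprK.
Qed.

Lemma quotient_ind N (P : quotient mul N -> Prop) :
  (forall x, P (quotient_proj mul N x)) -> forall C, P C.
Proof. by move=> Pp C; rewrite -(quotient_reprK C). Qed.

Lemma coset_Mlt_inj N f x y : normal_subloop mul e N -> Mlt mul f ->
  coset mul N (f x) = coset mul N (f y) -> coset mul N x = coset mul N y.
Proof.
move=> Nn fM fxy; have [fK _] := inverseK (Mlt_bij fM).
have E z := coset_Mlt z Nn (Mlt_inverse fM).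
by rewrite -(fK x) -(fK y) -!E fxy.
Qed.

Lemma quotient_loop N : normal_subloop mul e N ->
  is_loop (@quotient_mul Q mul N) (quotient_proj mul N e).
Proof.
move=> Nn; have pM := quotient_projM Nn; case: (Qloop) => Lb Rb idl idr.
have bij (f : Q -> Q) (F : quotient mul N -> quotient mul N) : Mlt mul f ->
    (forall x, F (quotient_proj mul N x) = quotient_proj mul N (f x)) ->
    bijective F.
  move=> fM Ff; have [fK Kf] := inverseK (Mlt_bij fM).
  pose G (C : quotient mul N) :=
    quotient_proj mul N (inverse e f (quotient_repr C)).
  have GK : cancel G F by move=> C; rewrite /G Ff Kf quotient_reprK.
  exists G => // C; elim/quotient_ind: C => x.
  elim/quotient_ind: (G _) (GK (F (quotient_proj mul N x))) => y.
  rewrite !Ff => /quotient_projE fyx; apply/quotient_projE.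
  exact: coset_Mlt_inj fyx.
split.
- elim/quotient_ind=> x; apply: (bij (mul x)) => [|y]; first exact: Mlt_left.
  by rewrite pM.
- elim/quotient_ind=> x; apply: (bij (mul^~ x)) => [|y]; first exact: Mlt_right.
  by rewrite pM.
- by elim/quotient_ind=> x; rewrite -pM idl.
- by elim/quotient_ind=> x; rewrite -pM idr.
Qed.

Lemma center_subloop : subloop mul e (center mul).
Proof.
case: (Qloop) => Lb _ idl idr.
have cV a : center mul a -> exists2 b, center mul b & mul b a = e.
  move=> Za; have [b ab] : exists b, mul a b = e.
    by have [g _ gK] := Lb a; exists (g e).
  have aI := bij_inj (Lb a).
  have C x : mul a x = mul x a by case: (Za x x).
  have A1 x y : mul (mul a x) y = mul a (mul x y) by case: (Za x y).
  have A2 x y : mul (mul x a) y = mul x (mul a y) by case: (Za x y).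
  have bK x : mul a (mul b x) = x by rewrite -A1 ab idl.
  have Cb x : mul b x = mul x b by apply: aI; rewrite bK -A1 C A2 ab idr.
  have B1 x y : mul (mul b x) y = mul b (mul x y).
    by apply: aI; rewrite -A1 !bK.
  have B2 x y : mul x (mul b y) = mul b (mul x y).
    by apply: aI; rewrite bK -A1 C A2 bK.
  exists b; last by rewrite -C.
  move=> x y; split=> //; first by rewrite -Cb B1 B2.
  by rewrite -Cb -[mul y b]Cb B2.
have cM a b : center mul a -> center mul b -> center mul (mul a b).
  move=> Za Zb.
  have C x : mul a x = mul x a by case: (Za x x).
  have A1 x y : mul (mul a x) y = mul a (mul x y) by case: (Za x y).
  have A2 x y : mul (mul x a) y = mul x (mul a y) by case: (Za x y).
  have A3 x y : mul (mul x y) a = mul x (mul y a) by case: (Za x y).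
  have Cb x : mul b x = mul x b by case: (Zb x x).
  have B1 x y : mul (mul b x) y = mul b (mul x y) by case: (Zb x y).
  have B2 x y : mul (mul x b) y = mul x (mul b y) by case: (Zb x y).
  have B3 x y : mul (mul x y) b = mul x (mul y b) by case: (Zb x y).
  move=> x y; split.
  - by rewrite A1 Cb -A1 C B3.
  - by rewrite !A1 B1.
  - by rewrite -B3 B2 A2 -A1.
  - by rewrite -B3 A3 B3 B3.
split=> //.
- by move=> x y; rewrite !idl !idr.
- move=> a b Za; have [c Zc ca] := cV a Za => Zab.
  suff -> : b = mul c (mul a b) by exact: cM.
  by have [_ <- _ _] := Zc a b; rewrite ca idl.
- move=> a b Zb; have [c Zc cb] := cV b Zb => Zab.
  suff -> : a = mul c (mul a b) by exact: cM.
  have [<- _ _ _] := Zb a a.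
  by have [_ <- _ _] := Zc b a; rewrite cb idl.
Qed.

End LoopTheory.

Lemma upper_center_normal (Q : Type) (mul : Q -> Q -> Q) (e : Q) (n : nat) :
  is_loop mul e -> normal_subloop mul e (upper_center mul e n).
Proof.
move=> Qloop; case: (Qloop) => Lb Rb idl idr.
elim: n => [|n Nn] /=.
  split; last by move=> f x [_ fe] ->; exact: fe.
  split=> //.
  - by move=> x y -> ->; rewrite idl.
  - by move=> x y ->; rewrite idl.
  - by move=> x y ->; rewrite idr.
set N := upper_center mul e n in Nn *.
have pM := quotient_projM Qloop Nn.
have [Ze ZM Zl Zr] := center_subloop (quotient_loop Qloop Nn).
split.
  split; first exact: Ze.
  - by move=> x y; rewrite /preimage /= pM; exact: ZM.
  - by move=> x y; rewrite /preimage /= pM; exact: Zl.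
  - by move=> x y; rewrite /preimage /= pM; exact: Zr.
move=> f a [fM fe] /= Za.
suff fa : forall x, quotient_proj mul N (f (mul a x)) =
                    quotient_proj mul N (mul a (f x)).
  by have := fa e; rewrite fe !idr => ->.
have C1 x y : quotient_proj mul N (mul y (mul a x)) =
              quotient_proj mul N (mul a (mul y x)).
  rewrite !pM; have [ay ayx _ _] := Za (quotient_proj mul N y)
    (quotient_proj mul N x).
  have [_ _ yax _] := Za (quotient_proj mul N y) (quotient_proj mul N x).
  by rewrite -yax -ay ayx.
have C2 x y : quotient_proj mul N (mul (mul a x) y) =
              quotient_proj mul N (mul a (mul x y)).
  rewrite !pM.
  by have [_ -> _ _] := Za (quotient_proj mul N x) (quotient_proj mul N y).
elim: fM {fe} => //.
- move=> g h gM gE hM hE x /=.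
  rewrite -gE; apply/quotient_projE.
  rewrite -!(coset_Mlt Qloop _ Nn gM); congr (image _ _).
  exact/quotient_projE.
- move=> g h gM gE gh hg x; apply/quotient_projE.
  apply: (coset_Mlt_inj Qloop Nn gM); rewrite hg.
  by apply/quotient_projE; rewrite gE hg.
Qed.

(* Main.v *)
(* Write L_x for the translation by x, ' for inversion, and
   P_x := L_x'^-1 L_x = L_x L_x'^-1, so that (x o y)^2 = P_x (y^2). If a is
   central for o, then P_a commutes with every P_x. Conjugation by L_(x^2)
   agrees on P_a with an automorphism, because L_x L_x' and L_(x^2)^-1 L_x^2 are
   inner; as every element is a square, L_x P_a = P_b L_x with P_b again
   commuting with every P_y. The same b serves for x', and the automorphic
   inverse property then forces b = a. Hence P_a commutes with every L_x, so
   that a^2 = P_a 1 is central, and so is a, being fixed by every inner mapping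
   because a^2 is. The converse inclusion of centers is a computation.

   For higher n, Q/Z_n is again a uniquely 2-divisible commutative automorphic
   loop, squaring staying injective since square roots of central elements are
   central, and x o Z_n = x Z_n; so both (n+1)-st centers are the preimage of
   the same center of Q/Z_n. *)
Require Import Defs.
From mathcomp Require Import all_boot all_classical.

Set Implicit Arguments.
Unset Strict Implicit.
Unset Printing Implicit Defensive.

Local Open Scope classical_set_scope.

(** * Division in a loop *)

Section Loop.
Context {Q : Type} (mul : Q -> Q -> Q) (e : Q) (Qloop : is_loop mul e).
Local Notation "x * y" := (mul x y).
Local Notation "x \\ y" := (ldiv mul e x y) (at level 40).
Local Notation "x ^-1" := (loop_inv mul e x).

Lemma loop_mul1l x : e * x = x. Proof. by case: Qloop. Qed.
Lemma loop_mulr1 x : x * e = x. Proof. by case: Qloop. Qed.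

Lemma loop_ldivK x y : x * (x \\ y) = y.
Proof. by case: Qloop => Lb _ _ _; case: (inverseK e (Lb x)) => _ ->. Qed.

Lemma loop_mulK x y : x \\ (x * y) = y.
Proof. by case: Qloop => Lb _ _ _; case: (inverseK e (Lb x)) => + _; exact. Qed.

Lemma loop_mulI x : injective (mul x).
Proof. exact: can_inj (loop_mulK x). Qed.

Lemma loop_ldiv_eq x y z : x * z = y -> x \\ y = z.
Proof. by move=> <-; exact: loop_mulK. Qed.

Lemma loop_mulV x : x * x^-1 = e. Proof. exact: loop_ldivK. Qed.

End Loop.

(** * Inner mappings and inversion in commutative automorphic loops *)

Section CommutativeAutomorphicLoop.
Context {Q : Type} (mul : Q -> Q -> Q) (e : Q) (Qloop : is_loop mul e).
Context (Qcomm : commutative mul) (Qauto : automorphic mul e).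
Local Notation "x * y" := (mul x y).
Local Notation "x \\ y" := (ldiv mul e x y) (at level 40).
Local Notation "x ^-1" := (loop_inv mul e x).
Local Notation mul1l := (loop_mul1l Qloop).
Local Notation mulr1 := (loop_mulr1 Qloop).
Local Notation ldivK := (loop_ldivK Qloop).
Local Notation mulK := (loop_mulK Qloop).
Local Notation mulI := (loop_mulI Qloop).
Local Notation ldiv_eq := (loop_ldiv_eq Qloop).
Local Notation mulV := (loop_mulV Qloop).

Lemma mulVl x : x^-1 * x = e. Proof. by rewrite Qcomm mulV. Qed.

Lemma loop_invK x : x^-1^-1 = x.
Proof. by apply: (@mulI x^-1); rewrite mulV mulVl. Qed.

Lemma automorphism1 f : automorphism mul f -> f e = e.
Proof. by move=> [_ fM]; apply: (@mulI (f e)); rewrite -fM !mulr1. Qed.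

Lemma automorphismV f x : automorphism mul f -> f x^-1 = (f x)^-1.
Proof.
move=> fA; apply: (@mulI (f x)); case: (fA) => _ <-.
by rewrite !mulV automorphism1.
Qed.

Lemma automorphism_inverse f : automorphism mul f ->
  exists g, [/\ automorphism mul g, cancel f g & cancel g f].
Proof.
move=> [[g fg gf] fM]; exists g; split=> //; split; first by exists f.
by move=> x y; apply: (can_inj fg); rewrite fM !gf.
Qed.

(** The mappings L_(xy)^-1 L_x L_y are the standard generators of the inner mapping group of a
    commutative loop. *)
Definition inner x y z := (x * y) \\ (x * (y * z)).

Lemma innerE x y z : x * y * inner x y z = x * (y * z).
Proof. exact: ldivK. Qed.

Lemma inner_automorphism x y : automorphism mul (inner x y).
Proof.
apply: Qauto; split; last by rewrite /= /inner mulr1; apply: ldiv_eq; rewrite mulr1.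
apply: (@Mlt_comp _ _ (ldiv mul e (x * y)) (mul x \o mul y)).
  by apply: (Mlt_inverse Qloop); exact: Mlt_left.
by apply: Mlt_comp; exact: Mlt_left.
Qed.

Lemma inner_fixl x y : inner x y x = x.
Proof. by apply: ldiv_eq; rewrite [y * x]Qcomm Qcomm. Qed.

(** The automorphism [inner x y] fixes x, hence also x', which means x (y x') = (x y) x'. *)
Lemma mulV_mulC x y : x * (x^-1 * y) = x^-1 * (x * y).
Proof.
have := inner_fixl x y => /(congr1 (loop_inv mul e)).
rewrite -(automorphismV _ (inner_automorphism x y)) => E.
by rewrite [x^-1 * y]Qcomm -innerE E Qcomm.
Qed.

Lemma mulV_mul_automorphism x : automorphism mul (fun y => x^-1 * (x * y)).
Proof.
apply: Qauto; split; last by rewrite /= mulr1 mulVl.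
by apply: (@Mlt_comp _ _ (mul x^-1) (mul x)); exact: Mlt_left.
Qed.

(* Conjugating L_y' by inner x y, which sends y' to w := (x * y) \\ x, gives
   L_x L_y' L_x^-1 = L_z L_w L_z^-1 for z := x * y; since z * w = x and
   inner z w fixes z, evaluating at e gives the claim. *)
Lemma loop_invM x y : (x * y)^-1 = x^-1 * y^-1.
Proof.
set z := x * y; pose w := z \\ x.
have zw : z * w = x by exact: ldivK.
have fA := inner_automorphism x y; case: (fA) => _ fM.
have fy : inner x y y^-1 = w by rewrite /inner mulV mulr1.
have E v : x * (y^-1 * (x \\ v)) = z * (w * (z \\ v)).
  pose u := y \\ (x \\ v); have yu : y * u = x \\ v by exact: ldivK.
  rewrite -yu -mulV_mulC -innerE fM fy -/z; congr (_ * (_ * _)).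
  by rewrite /inner yu ldivK.
have := inner_automorphism z w => zA.
rewrite -[in LHS](inner_fixl z w) -(automorphismV _ zA).
by rewrite /inner -E zw mulK Qcomm.
Qed.

Lemma inner_inv x y z : inner x^-1 y^-1 z = inner x y z.
Proof.
apply: ldiv_eq; rewrite -loop_invM -[z]loop_invK.
by rewrite (automorphismV _ (inner_automorphism x y)) -!loop_invM innerE.
Qed.

(** * The mappings P_x *)

Definition bruck_P x y := x^-1 \\ (x * y).

Lemma bruck_PE x y : x^-1 * bruck_P x y = x * y.
Proof. exact: ldivK. Qed.

Lemma bruck_P_eq x y z : x^-1 * z = x * y -> bruck_P x y = z.
Proof. exact: ldiv_eq. Qed.

Lemma bruck_PK x : cancel (bruck_P x) (bruck_P x^-1).
Proof. by move=> y; apply: bruck_P_eq; rewrite loop_invK bruck_PE. Qed.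

Lemma bruck_PVK x : cancel (bruck_P x^-1) (bruck_P x).
Proof. by move=> y; rewrite -{1}[x]loop_invK bruck_PK. Qed.

Lemma bruck_Pe x : bruck_P x e = x * x.
Proof. by apply: bruck_P_eq; rewrite -mulV_mulC mulVl. Qed.

Lemma bruck_P_mulV x y : bruck_P x (x^-1 * y) = x * y.
Proof. by apply: bruck_P_eq; rewrite mulV_mulC. Qed.

Lemma bruck_PV x y : (bruck_P x y)^-1 = bruck_P x^-1 y^-1.
Proof.
by apply/esym/bruck_P_eq; rewrite -loop_invM bruck_PE loop_invM.
Qed.

Lemma bruck_P_automorphism f x y : automorphism mul f ->
  f (bruck_P x y) = bruck_P (f x) (f y).
Proof.
move=> fA; case: (fA) => _ fM; apply/esym/bruck_P_eq.
by rewrite -automorphismV// -!fM bruck_PE.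
Qed.

(** The automorphism [inner x x] fixes x, so it commutes with P_x. It equals both L_(x^2)^-1 L_x^2
    and the same expression in x', which reduces P_(x^2) to L_x'^-2 L_x^2 = P_x^2. *)
Lemma bruck_P_square x y : bruck_P (x * x) y = bruck_P x (bruck_P x y).
Proof.
have fA := inner_automorphism x x.
have [g [_ fg gf]] := automorphism_inverse fA.
rewrite -[y]gf; set u := g y.
have fP v : bruck_P x (inner x x v) = inner x x (bruck_P x v).
  by rewrite (bruck_P_automorphism _ _ fA) inner_fixl.
rewrite !fP; apply: bruck_P_eq.
rewrite innerE loop_invM -inner_inv innerE.
by rewrite bruck_PE -mulV_mulC bruck_PE.
Qed.

(** * Two forms of centrality *)

Lemma center_comm_loop a :
  (forall x y, a * (x * y) = x * (a * y)) -> center mul a.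
Proof.
move=> aC x y.
have A : a * x * y = a * (x * y) by rewrite [LHS]Qcomm -aC [y * x]Qcomm.
split; [exact: Qcomm|exact: A| |].
- by rewrite [x * a]Qcomm A aC.
- by rewrite Qcomm aC [a * y]Qcomm.
Qed.

Lemma center_mulCA a x y : center mul a -> a * (x * y) = x * (a * y).
Proof. by move=> Za; case: (Za x y) => C <- <- _; rewrite C. Qed.

Lemma center_mulA a x y : center mul a -> a * x * y = a * (x * y).
Proof. by move=> Za; case: (Za x y). Qed.

(** Centrality for the Bruck operation in a form free of square roots, and so visibly preserved by
    automorphisms. *)
Definition bruck_P_central a :=
  forall x y, bruck_P a (bruck_P x y) = bruck_P x (bruck_P a y).

Lemma bruck_P_central_automorphism f a : automorphism mul f ->
  bruck_P_central a -> bruck_P_central (f a).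
Proof.
move=> fA Ka x y; have [g [_ fg gf]] := automorphism_inverse fA.
by rewrite -[x]gf -[y]gf -!(bruck_P_automorphism _ _ fA) Ka.
Qed.

Lemma bruck_P_central_mulV a x y : bruck_P_central a ->
  x^-1 * bruck_P a (bruck_P x y) = x * bruck_P a y.
Proof. by move=> ->; rewrite bruck_PE. Qed.

(** Since L_x P_a = L_x' P_a P_x, one factor L_x on the left can be traded for L_x'; the
    automorphism L_x' L_x then carries P_a across. *)
Lemma bruck_P_central_mul2 a x y : bruck_P_central a ->
  x * (x * bruck_P a y) = bruck_P (x^-1 * (x * a)) (x * (x * y)).
Proof.
move=> Ka; rewrite -bruck_P_central_mulV// mulV_mulC.
rewrite (bruck_P_automorphism _ _ (mulV_mul_automorphism x)).
by rewrite -[x * y]bruck_PE mulV_mulC.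
Qed.

(** * Unique 2-divisibility and equality of the two centers *)

Section UniquelyTwoDivisible.
Context (Qdiv : uniquely_2_divisible mul).
Local Notation sqr := (square mul).
Local Notation "x 'o' y" := (bruck_mul mul e x y) (at level 40).

Lemma squareI : injective sqr. Proof. exact: bij_inj Qdiv. Qed.

Lemma sqrtK x : sqr (sqrt mul e x) = x.
Proof. by case: (inverseK e Qdiv) => _; apply. Qed.

Lemma bruck_P_central_mul a x : bruck_P_central a ->
  exists2 b, bruck_P_central b &
    forall y, x * bruck_P a y = bruck_P b (x * y).
Proof.
move=> Ka; rewrite -(sqrtK x); move: (sqrt _ _ x) => {}x; rewrite /square.
have fA := inner_automorphism x x.
have [g [gA fg gf]] := automorphism_inverse fA.
have Kg := bruck_P_central_automorphism gA Ka.
(* Here x is a square root of the original element, and L_(x^2) = L_x^2 g. Moving g past P_a gives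
   P_(g a), and moving L_x^2 past that gives P_b for this witness b. *)
exists (x^-1 * (x * g a)) => [|y].
  exact: bruck_P_central_automorphism (mulV_mul_automorphism x) Kg.
rewrite -{1}[a]gf -[y]gf -(bruck_P_automorphism _ _ fA) !innerE.
exact: bruck_P_central_mul2.
Qed.

(* Comparing c * x = P_b x with (c * x')' = P_b' x, where c := a * a, forces
   b^4 = a^4. *)
Lemma bruck_P_central_mulC a x y : bruck_P_central a ->
  x * bruck_P a y = bruck_P a (x * y).
Proof.
move=> Ka; have [b Kb xb] := bruck_P_central_mul x Ka.
suff ab : a = b by rewrite xb ab.
have xVb z : x^-1 * bruck_P a z = bruck_P b (x^-1 * z).
  by rewrite -[z](bruck_PVK x) bruck_P_central_mulV// xb bruck_PE.
pose c := a * a.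
have cx : c * x = bruck_P b x by rewrite Qcomm /c -bruck_Pe xb mulr1.
have cxV : c * x^-1 = bruck_P b x^-1 by rewrite Qcomm /c -bruck_Pe xVb mulr1.
have cVx : c^-1 * x = bruck_P b^-1 x.
  by rewrite -[x in LHS]loop_invK -loop_invM cxV bruck_PV loop_invK.
(* c x = P_c (c' x), where P_c = P_a^2 and c' x = P_b' x; applying P_b to both sides cancels
   P_b'. *)
have E : bruck_P b (bruck_P b x) = bruck_P a (bruck_P a x).
  by rewrite -cx -bruck_P_mulV bruck_P_square cVx !(Kb a) bruck_PVK.
(* With x = s^2 = P_s 1, the factor P_s moves to the front and cancels, leaving P_b^2 1 = P_a^2 1,
   that is b^4 = a^4. *)
move: E; rewrite -(sqrtK x) /square -bruck_Pe !Kb !Ka.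
move=> /(can_inj (bruck_PK _)); rewrite -!bruck_P_square !bruck_Pe.
by move=> /squareI/squareI.
Qed.

Lemma center_square a : center mul (sqr a) -> center mul a.
Proof.
move=> Zc; apply: center_comm_loop => x y.
suff fa : inner x y a = a by rewrite [a * y]Qcomm -[RHS]innerE fa Qcomm.
have [_ fM] := inner_automorphism x y.
apply: squareI; rewrite /square -fM; apply: ldiv_eq.
by rewrite Qcomm (center_mulCA _ _ Zc) [square mul a * y]Qcomm.
Qed.

Lemma bruck_P_central_center a : bruck_P_central a -> center mul a.
Proof.
move=> Ka; have PE x : sqr a * x = bruck_P a x.
  by rewrite Qcomm /square -bruck_Pe bruck_P_central_mulC// mulr1.
apply: center_square; apply: center_comm_loop => x y.
by rewrite !PE bruck_P_central_mulC.
Qed.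

Lemma square_bruck_mul x y : sqr (x o y) = bruck_P x (sqr y).
Proof. exact: sqrtK. Qed.

Lemma center_bruck_P_central a :
  center (bruck_mul mul e) a -> bruck_P_central a.
Proof.
move=> Za x y; rewrite -(sqrtK y) -!square_bruck_mul.
by congr (sqr _); case: (Za x (sqrt mul e y)) => C <- <- _; rewrite C.
Qed.

Lemma center_square_mul a x : center mul a -> sqr (a * x) = a * (a * sqr x).
Proof.
by move=> Za; rewrite /square center_mulA// -(center_mulCA x x Za).
Qed.

Lemma center_bruck_P a x y : center mul a ->
  bruck_P (a * x) y = a * (a * bruck_P x y).
Proof.
move=> Za; apply: bruck_P_eq; rewrite -!(center_mulCA _ _ Za).
rewrite loop_invM -(center_mulA (a^-1 * x^-1) _ Za) -(center_mulA a^-1 _ Za) mulV mul1l.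
by rewrite bruck_PE center_mulA.
Qed.

Lemma center_bruck_Pr a x y : center mul a ->
  bruck_P x (a * y) = a * bruck_P x y.
Proof.
by move=> Za; apply: bruck_P_eq; rewrite -!(center_mulCA _ _ Za) bruck_PE.
Qed.

(** Both sides have the square a^2 P_x (y^2). *)
Lemma center_bruck_mulAl a x y : center mul a -> (a * x) o y = a * (x o y).
Proof.
move=> Za; apply: squareI.
by rewrite center_square_mul// !square_bruck_mul center_bruck_P.
Qed.

Lemma center_bruck_mulAr a x y : center mul a -> x o (a * y) = a * (x o y).
Proof.
move=> Za; apply: squareI.
rewrite center_square_mul// !square_bruck_mul center_square_mul//.
by rewrite !(center_bruck_Pr _ _ Za).
Qed.

Lemma bruck_mul1l x : e o x = x.
Proof.
apply: squareI; rewrite square_bruck_mul; apply: bruck_P_eq.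
by congr (_ * _); apply: (@mulI e); rewrite mulV mul1l.
Qed.

Lemma bruck_mulr1 x : x o e = x.
Proof. by apply: squareI; rewrite square_bruck_mul /square mul1l bruck_Pe. Qed.

Lemma bruck_mulI x : injective (bruck_mul mul e x).
Proof.
move=> y z /(congr1 sqr); rewrite !square_bruck_mul.
by move=> /(can_inj (bruck_PK _))/squareI.
Qed.

Lemma bruck_mul_surj x y : exists z, x o z = y.
Proof.
exists (sqrt mul e (bruck_P x^-1 (sqr y))); apply: squareI.
by rewrite square_bruck_mul sqrtK bruck_PVK.
Qed.

Lemma center_bruck : center (bruck_mul mul e) = center mul.
Proof.
apply/seteqP; split=> a Za.
  exact: bruck_P_central_center (center_bruck_P_central Za).
have L x : a o x = a * x by rewrite -{1}[a]mulr1 center_bruck_mulAl// bruck_mul1l.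
have R x : x o a = a * x by rewrite -{1}[a]mulr1 center_bruck_mulAr// bruck_mulr1.
move=> x y; rewrite !L !R; split=> //.
- by rewrite center_bruck_mulAl.
- by rewrite center_bruck_mulAl// center_bruck_mulAr.
- by rewrite center_bruck_mulAr.
Qed.

End UniquelyTwoDivisible.
End CommutativeAutomorphicLoop.

(** * Transfer along morphisms *)

Lemma bruck_mul_morph (Q A : Type) (mul : Q -> Q -> Q) (opA : A -> A -> A)
    (e : Q) (eA : A) (p : Q -> A) : is_loop mul e -> is_loop opA eA ->
  uniquely_2_divisible mul -> uniquely_2_divisible opA ->
  p e = eA -> {morph p : x y / mul x y >-> opA x y} ->
  {morph p : x y / bruck_mul mul e x y >-> bruck_mul opA eA x y}.
Proof.
move=> Ql Al Q2 A2 pe pM x y.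
have pD u v : p (ldiv mul e u v) = ldiv opA eA (p u) (p v).
  by apply/esym/(loop_ldiv_eq Al); rewrite -pM (loop_ldivK Ql).
apply: (squareI A2); rewrite (sqrtK eA A2) /square -pM.
by rewrite [mul _ _](sqrtK e Q2) pD pD pe !pM.
Qed.

(** Quotients of the two loops are different types, so their centers are compared through preimages
    in Q. Centrality is a family of equations between images, which passes from q to p when the
    fibres of q refine those of p. *)
Lemma center_surj_morph (Q A B : Type) (op : Q -> Q -> Q) (opA : A -> A -> A)
    (opB : B -> B -> B) (p : Q -> A) (q : Q -> B) a :
  (forall X, exists x, p x = X) ->
  {morph p : x y / op x y >-> opA x y} -> {morph q : x y / op x y >-> opB x y} ->
  (forall x y, q x = q y -> p x = p y) ->
  center opB (q a) -> center opA (p a).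
Proof.
move=> pS pM qM qp Za X Y; have [x <-] := pS X; have [y <-] := pS Y.
have [C A1 A2 A3] := Za (q x) (q y).
by rewrite -!pM; split; apply: qp; rewrite !qM.
Qed.

(** * Quotients by a normal subloop *)

Section Quotient.
Context {Q : Type} (mul : Q -> Q -> Q) (e : Q) (Qloop : is_loop mul e).
Context (N : set Q) (Nn : normal_subloop mul e N).
Local Notation p := (quotient_proj mul N).

Let pind := @quotient_ind Q mul N.

(** In place of associativity, p (x n) = p x p n is used, with p n = p e because n N = N. *)
Lemma quotient_proj_eqP x y : p y = p x <-> coset mul N x y.
Proof.
have [Ne NM Nl _] := Nn.1; split=> [/quotient_projE xy|[n Nn' <-]].
  by rewrite -xy; exists e => //; rewrite (loop_mulr1 Qloop).
rewrite (quotient_projM Qloop Nn) -[in RHS](loop_mulr1 Qloop x).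
rewrite [in RHS](quotient_projM Qloop Nn); congr quotient_mul.
apply/quotient_projE/seteqP; split=> z [m Nm <-].
  by exists (mul n m); [exact: NM|rewrite (loop_mul1l Qloop)].
exists (ldiv mul e n m); last by rewrite (loop_ldivK Qloop) (loop_mul1l Qloop).
by apply: (Nl n); rewrite ?(loop_ldivK Qloop).
Qed.

Lemma quotient_comm : commutative mul -> commutative (@quotient_mul Q mul N).
Proof.
move=> Qcomm; elim/pind=> x; elim/pind=> y.
by rewrite -!(quotient_projM Qloop Nn) Qcomm.
Qed.

Lemma Mlt_quotient F : Mlt (@quotient_mul Q mul N) F ->
  exists2 f, Mlt mul f & forall x, F (p x) = p (f x).
Proof.
have pM := quotient_projM Qloop Nn.
elim=> {F}.
- elim/pind=> x; exists (mul x); first exact: Mlt_left.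
  by move=> y; rewrite pM.
- elim/pind=> x; exists (mul^~ x); first exact: Mlt_right.
  by move=> y; rewrite pM.
- by exists id => //; exact: Mlt_id.
- move=> F G _ [f fM Ff] _ [g gM Gg]; exists (f \o g); first exact: Mlt_comp.
  by move=> x /=; rewrite Gg Ff.
- move=> F G _ [f fM Ff] FG _; exists (inverse e f).
    exact: (Mlt_inverse Qloop).
  have [_ Kf] := inverseK e (Mlt_bij Qloop fM).
  by move=> x; rewrite -{1}[x]Kf -Ff FG.
Qed.

Lemma quotient_automorphic :
  automorphic mul e -> automorphic (@quotient_mul Q mul N) (p e).
Proof.
move=> Qauto F [FM Fe]; have pM := quotient_projM Qloop Nn.
split; first exact: (Mlt_bij (quotient_loop Qloop Nn)).
have [f fM Ff] := Mlt_quotient FM.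
(* The lift f may move e inside N; dividing by f e makes it inner and leaves the induced mapping
   unchanged. *)
pose g := ldiv mul e (f e) \o f.
have gM : Mlt mul g.
  by apply: Mlt_comp fM; apply: (Mlt_inverse Qloop); exact: Mlt_left.
have [] : automorphism mul g.
  apply: Qauto; split=> //; apply: (loop_ldiv_eq Qloop).
  exact: (loop_mulr1 Qloop).
move=> _ gD; have Fg x : F (p x) = p (g x).
  rewrite Ff -[in LHS](loop_ldivK Qloop (f e) (f x)) pM -Ff Fe -pM.
  by rewrite (loop_mul1l Qloop).
elim/pind=> x; elim/pind=> y.
by rewrite -pM !Fg gD pM.
Qed.

(** Square roots descend from Q, but injectivity of squaring can fail in a quotient (the rationals
    modulo the integers), so it is assumed. *)
Lemma quotient_2_divisible : uniquely_2_divisible mul ->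
  (forall x y, p (square mul x) = p (square mul y) -> p x = p y) ->
  uniquely_2_divisible (@quotient_mul Q mul N).
Proof.
move=> Q2 pI; have pM := quotient_projM Qloop Nn.
pose r (C : quotient mul N) := p (sqrt mul e (quotient_repr C)).
have rK : cancel r (square (@quotient_mul Q mul N)).
  by move=> C; rewrite /square -pM [mul _ _](sqrtK e Q2) quotient_reprK.
exists r => // C; have := rK (square (@quotient_mul Q mul N) C).
elim/pind: (r _) => x; elim/pind: C => y.
by rewrite /square -!pM => /pI.
Qed.

End Quotient.

(** * The upper central series *)

Section UpperCenter.
Context {Q : Type} (mul : Q -> Q -> Q) (e : Q) (Qloop : is_loop mul e).
Context (Qcomm : commutative mul) (Qauto : automorphic mul e).
Context (Qdiv : uniquely_2_divisible mul).

Lemma quotient_upper_center_2_divisible n :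
  uniquely_2_divisible (@quotient_mul Q mul (upper_center mul e n)).
Proof.
elim: n => [|n IH].
  have Nn := upper_center_normal 0 Qloop; apply: (quotient_2_divisible Qloop) => //.
  move=> x y /(quotient_proj_eqP Qloop Nn) [_ ->].
  by rewrite (loop_mulr1 Qloop) => /(squareI Qdiv) ->.
have Nn := upper_center_normal n Qloop.
have Nn1 := upper_center_normal n.+1 Qloop.
have pM := quotient_projM Qloop Nn; have Al := quotient_loop Qloop Nn.
apply: (quotient_2_divisible Qloop) => //.
set p := quotient_proj mul (upper_center mul e n) in pM Al.
move=> x y /(quotient_proj_eqP Qloop Nn1) [m Zm].
(* Modulo Z_n, w is central and x^2 = y^2 w^2 = (y w)^2, so induction gives x = y w there. *)
pose w := sqrt mul e m; have wm : square mul w = m by exact: sqrtK.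
have Zw : center (@quotient_mul Q mul (upper_center mul e n)) (p w).
  apply: (center_square Al (quotient_comm Qloop Nn Qcomm)
    (quotient_automorphic Qloop Nn Qauto) IH).
  by rewrite /square -pM [mul w w]wm.
move=> E; have {}E : p x = p (mul y w).
  apply: (squareI IH); rewrite /square -pM -[mul x x]E -wm !pM.
  have C := quotient_comm Qloop Nn Qcomm.
  rewrite [quotient_mul (p y) (p w)]C [RHS](center_square_mul _ Zw).
  by rewrite C (center_mulA _ _ Zw).
apply/(quotient_proj_eqP Qloop Nn1); exists (ldiv mul e y x).
  suff: p (ldiv mul e y x) = p w by rewrite /= /preimage /= -/p => ->.
  by apply: (loop_mulI Al (x := p y)); rewrite -!pM (loop_ldivK Qloop).
exact: (loop_ldivK Qloop).
Qed.

(** The projection also respects the Bruck operations. If y = x o z, then y and x agree modulo N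
    exactly when z is trivial modulo N, by left cancellation in the Bruck operation of Q/N. *)
Lemma coset_bruck N x : normal_subloop mul e N ->
  uniquely_2_divisible (@quotient_mul Q mul N) ->
  coset (bruck_mul mul e) N x = coset mul N x.
Proof.
move=> Nn A2; have pM := quotient_projM Qloop Nn.
have Al := quotient_loop Qloop Nn; have AC := quotient_comm Qloop Nn Qcomm.
have Aa := quotient_automorphic Qloop Nn Qauto.
have pB := bruck_mul_morph Qloop Al Qdiv A2 erefl pM.
have NP y : N y <-> quotient_proj mul N y = quotient_proj mul N e.
  split=> [Ny|/(quotient_proj_eqP Qloop Nn) [n Nn' <-]].
    by apply/(quotient_proj_eqP Qloop Nn); exists y; rewrite ?(loop_mul1l Qloop).
  by rewrite (loop_mul1l Qloop).
have xP y z : bruck_mul mul e x z = y ->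
    N z <-> quotient_proj mul N y = quotient_proj mul N x.
  move=> <-; rewrite pB; split=> [/NP ->|E]; first exact: bruck_mulr1 Al AC Aa A2 _.
  apply/NP; apply: (bruck_mulI Al AC A2 (x := quotient_proj mul N x)).
  by rewrite E (bruck_mulr1 Al AC Aa A2).
apply/seteqP; split=> y; last first.
  move=> /(quotient_proj_eqP Qloop Nn) E.
  have [z xz] := bruck_mul_surj Qloop Qcomm Qdiv x y.
  by exists z => //; apply/(xP _ _ xz).
by case=> z Nz xz; apply/(quotient_proj_eqP Qloop Nn)/(xP _ _ xz).
Qed.

End UpperCenter.

Theorem theorem1p2 (Q : Type) (mul : Q -> Q -> Q) (e : Q)
    (Qloop : is_loop mul e) (Qcomm : commutative mul)
    (Qauto : automorphic mul e) (Qdiv : uniquely_2_divisible mul) (n : nat) :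
  upper_center (bruck_mul mul e) e n = upper_center mul e n.
Proof.
elim: n => //= n ->; set N := upper_center mul e n.
have Nn : normal_subloop mul e N by exact: upper_center_normal.
have A2 : uniquely_2_divisible (@quotient_mul Q mul N).
  exact: quotient_upper_center_2_divisible.
have pM := quotient_projM Qloop Nn.
have Al := quotient_loop Qloop Nn; have AC := quotient_comm Qloop Nn Qcomm.
have Aa := quotient_automorphic Qloop Nn Qauto.
have pB := bruck_mul_morph Qloop Al Qdiv A2 erefl pM.
pose q := quotient_proj (bruck_mul mul e) N.
have qp x y : q x = q y <-> quotient_proj mul N x = quotient_proj mul N y.
  by split=> /quotient_projE E; apply/quotient_projE; move: E; rewrite !coset_bruck.
(* [quotient_mul] multiplies chosen representatives; by [qp] these have the same images in Q/N as x
   and y, so [pB] applies. *)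
have qM : {morph q : x y / bruck_mul mul e x y >-> quotient_mul x y}.
  move=> x y; apply/qp; rewrite !pB.
  by congr bruck_mul; apply/qp; rewrite /q quotient_reprK.
(* Passing to the Bruck operation of Q/N makes both projections morphisms from the same operation on
   Q. *)
rewrite -(center_bruck Al AC Aa A2).
have qS X : exists x, q x = X by exists (quotient_repr X); exact: quotient_reprK.
have pS (X : quotient mul N) : exists x, quotient_proj mul N x = X.
  by exists (quotient_repr X); exact: quotient_reprK.
apply/seteqP; split=> a /= Za.
  by apply: (center_surj_morph pS pB qM _ Za) => x y /qp.
by apply: (center_surj_morph qS qM pB _ Za) => x y /qp.
Qed.
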